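(* For every $n\ge 0$, $$\mathrm{RS}_n(111,1212)=\sum_{P\in\mathcal{M}_n}q^{l(P)}.$$
   Context: A restricted growth function (RGF) of length $n$ is a sequence $w=w_1\dots w_n$ of positive integers with $w_1=1$ and $w_i\le 1+\max\{w_1,\dots,w_{i-1}\}$ for $i\ge 2$; $R_0$ consists of the empty word and $R_n$ is the set of RGFs of length $n$. The standardization of a word replaces every occurrence of its smallest letter by $1$, of its next smallest letter by $2$, and so on. An RGF $w$ contains an RGF $v$ if some subword (subsequence, not necessarily consecutive) of $w$ standardizes to $v$; otherwise $w$ avoids $v$. $R_n(v_1,v_2)$ is the set of $w\in R_n$ avoiding both $v_1$ and $v_2$. For a word $w$ and position $j$, $\mathrm{rs}(w_j)$ is the number of distinct values $w_i$ with $i>j$ and $w_i<w_j$, $\mathrm{rs}(w)=\sum_j\mathrm{rs}(w_j)$, and $\mathrm{RS}_n(v_1,v_2)=\sum_{w\in R_n(v_1,v_2)}q^{\mathrm{rs}(w)}$. A Motzkin path of length $n$ is a lattice path from $(0,0)$ to $(n,0)$ staying weakly above the $x$-axis with steps up $(1,1)$, horizontal $(1,0)$ and down $(1,-1)$; $\mathcal{M}_n$ is the set of such paths. For a step $s_i$, its level $l(s_i)$ is the smaller of the $y$-coordinates of its two endpoints; for $P=s_1\dots s_n$, $l(P)=\sum_{i=1}^n l(s_i)$. *)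

(* Defs.v *)
From HB Require Import structures.
From mathcomp Require Import all_boot all_order all_algebra.

Set Implicit Arguments.
Unset Strict Implicit.
Unset Printing Implicit Defensive.

Import Order.TTheory GRing.Theory Num.Theory.

(* Words are sequences of naturals; positions are 0-based, so the letter w_1
   of the mathematical notation is [nth 0 w 0].  The conjunct on [head] says
   that w is empty or w_1 = 1. *)
Definition is_rgf (w : seq nat) : bool :=
  [&& all (fun a => 0 < a) w,
      head 1 w == 1 &
      [forall i : 'I_(size w),
         (0 < i) ==> (nth 0 w i <= 1 + \max_(j < i) nth 0 w j)]].

Definition standardize (w : seq nat) : seq nat :=
  [seq (index a (sort leq (undup w))).+1 | a <- w].

(* The masks of w enumerate its (not necessarily consecutive) subwords. *)
Definition contains (w v : seq nat) : bool :=
  [exists m : (size w).-tuple bool, standardize (mask m w) == v].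

Definition avoids (w v : seq nat) : bool := ~~ contains w v.

Definition rs_letter (w : seq nat) (j : nat) : nat :=
  size (undup [seq a <- drop j.+1 w | a < nth 0 w j]).

Definition rs (w : seq nat) : nat := \sum_(j < size w) rs_letter w j.

(* A word of length n with letters at most n, as a sequence of naturals. *)
Definition word (n : nat) (t : n.-tuple 'I_n.+1) : seq nat :=
  [seq val a | a <- t].

(* Justifies indexing R_n by tuples over 'I_n.+1. *)
Lemma rgf_word (n : nat) (w : seq nat) :
  is_rgf w -> size w = n -> exists t : n.-tuple 'I_n.+1, word t = w.
Proof.
case/and3P=> _ hd /forallP hmax szw.
have bnd i : i < size w -> nth 0 w i <= i.+1.
  elim/ltn_ind: i => -[|i] IH ltiw.
    by case: w hd {hmax szw IH} ltiw => //= a w /eqP->.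
  apply: leq_trans (implyP (hmax (Ordinal ltiw)) isT) _.
  rewrite /= add1n ltnS; apply/bigmax_leqP => j _.
  by apply: leq_trans (IH j (ltn_ord j) (ltn_trans (ltn_ord j) ltiw)) _.
have szt : size [seq inord a : 'I_n.+1 | a <- w] == n by rewrite size_map szw.
exists (Tuple szt); rewrite /word /= -map_comp -[RHS]map_id.
apply/eq_in_map => a /(nthP 0) [i ltiw <-] /=; rewrite inordK // ltnS.
by apply: leq_trans (bnd _ ltiw) _; rewrite -szw.
Qed.

Inductive step := Up | Horizontal | Down.

Definition step_to_ord (s : step) : 'I_3 :=
  match s with
  | Up => @Ordinal 3 0 isT
  | Horizontal => @Ordinal 3 1 isT
  | Down => @Ordinal 3 2 isT
  end.

Definition ord_to_step (i : 'I_3) : step :=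
  match val i with 0 => Up | 1 => Horizontal | _ => Down end.

Lemma step_to_ordK : cancel step_to_ord ord_to_step.
Proof. by case. Qed.

HB.instance Definition _ := Finite.copy step (can_type step_to_ordK).

Local Open Scope ring_scope.

Definition rise (s : step) : int :=
  match s with Up => 1 | Horizontal => 0 | Down => -1 end.

(* The lattice points of the path are (i, height P i), 0 <= i <= size P. *)
Definition height (P : seq step) (i : nat) : int :=
  \sum_(s <- take i P) rise s.

Definition is_motzkin (P : seq step) : bool :=
  (height P (size P) == 0) &&
  [forall i : 'I_(size P).+1, 0 <= height P i].

Definition step_level (P : seq step) (i : nat) : int :=
  Num.min (height P i) (height P i.+1).

Definition level (P : seq step) : int :=
  \sum_(i < size P) step_level P i.

Definition RS (n : nat) (v1 v2 : seq nat) : {poly int} :=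
  \sum_(t : n.-tuple 'I_n.+1 |
          [&& is_rgf (word t), avoids (word t) v1 & avoids (word t) v2])
     'X^(rs (word t)).

(* The level of a Motzkin path is nonnegative, so the absolute value only
   casts it to nat. *)
Definition motzkin_level_poly (n : nat) : {poly int} :=
  \sum_(P : n.-tuple step | is_motzkin P) 'X^(`|level P|%N).

(* Main.v *)
(* An RGF avoiding 111 and 1212 is a noncrossing partial matching of its
   positions: read the first of two equal letters as an up step, a letter
   occurring once as a horizontal step, and the second of two equal letters as
   a down step.  Conversely a Motzkin path is decoded with a stack of the
   letters awaiting their second occurrence, a down step emitting the top.
   At each position the smaller letters still to come are exactly the letters
   left on the stack below the current one, and their number is the level of
   the step; hence rs becomes the level of the path. *)
Require Import Defs.
From mathcomp Require Import all_boot all_order all_algebra.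
From mathcomp Require Import zify.

Set Implicit Arguments.
Unset Strict Implicit.
Unset Printing Implicit Defensive.

Import Order.TTheory GRing.Theory Num.Theory.

(** * Pattern avoidance as noncrossing matchings *)

Lemma containsP (w v : seq nat) :
  reflect (exists2 t, subseq t w & standardize t = v) (contains w v).
Proof.
apply: (iffP existsP) => [[m /eqP <-]|[t /subseqP[m szm ->] <-]].
  by exists (mask m w) => //; apply: mask_subseq.
by exists (tcast szm (in_tuple m)); rewrite val_tcast.
Qed.

(** Lets equalities between letters of [t] be read off its standardization. *)
Lemma index_sort_undup_inj (t : seq nat) :
  {in t &, injective (index^~ (sort leq (undup t)))}.
Proof.
move=> x y xt yt e; rewrite -[x](@nth_index _ 0 x (sort leq (undup t))).
  by rewrite e nth_index // mem_sort mem_undup.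
by rewrite mem_sort mem_undup.
Qed.

Lemma standardize_111 (t : seq nat) :
  standardize t = [:: 1; 1; 1] <-> exists a, t = nseq 3 a.
Proof.
split=> [|[a ->]]; last by rewrite /standardize /= !inE eqxx /= eqxx.
have := @index_sort_undup_inj t; rewrite /standardize.
case: t => [|a [|b [|c [|]]]] //.
set t := [:: a; b; c]; set s := sort _ _ => inj [ea eb ec].
have [at_ bt ct] : [/\ a \in t, b \in t & c \in t].
  by rewrite !inE !eqxx !orbT.
by exists a; congr [:: _; _; _]; apply: inj; rewrite // ?eb ?ec.
Qed.

Lemma standardize_1212 (t : seq nat) :
  standardize t = [:: 1; 2; 1; 2] <->
  exists a b, a < b /\ t = [:: a; b; a; b].
Proof.
split=> [|[a [b [ltab ->]]]]; last first.
  have nab : (a == b) = false by rewrite ltn_eqF.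
  have nba : (b == a) = false by rewrite gtn_eqF.
  rewrite /standardize /= !inE !eqxx !orbT /= nab /=.
  have -> : sort leq [:: a; b] = [:: a; b].
    by apply: sorted_sort; [apply: leq_trans | rewrite /= ltnW].
  by rewrite /= !eqxx nab.
have := @index_sort_undup_inj t; rewrite /standardize.
case: t => [|a [|b [|c [|d [|]]]]] //.
set t := [:: a; b; c; d]; set s := sort _ _ => inj [ea eb ec ed].
have [at_ bt ct dt] : [/\ a \in t, b \in t, c \in t & d \in t].
  by rewrite !inE !eqxx !orbT.
have st x : (x \in s) = (x \in t) by rewrite mem_sort mem_undup.
exists a, b; split; last first.
  by congr [:: _; _; _; _]; apply: inj; rewrite // ?ec ?ed.
have srt : sorted leq s by apply: sort_sorted; apply: leq_total.
(* In the sorted list [s] the letters [a] and [b] have indices 0 and 1, so [a <= b]; equality would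
   make the indices agree. *)
have := sorted_ltn_index leq_trans srt a b.
rewrite !st => /(_ at_ bt); rewrite -/s ea eb => /(_ isT).
by rewrite leq_eqVlt => /orP[/eqP eab|//]; rewrite eab eb in ea.
Qed.

Definition noncrossing_matching (w : seq nat) : Prop :=
  (forall a, count_mem a w <= 2) /\
  (forall a b, a < b -> ~~ subseq [:: a; b; a; b] w).

Lemma avoidsP (w : seq nat) :
  avoids w [:: 1; 1; 1] && avoids w [:: 1; 2; 1; 2] <-> noncrossing_matching w.
Proof.
split=> [/andP[/containsP av1 /containsP av2]|[av1 av2]].
  split=> [a|a b ltab].
    rewrite leqNgt; apply/negP => c3; apply: av1.
    exists (nseq 3 a); last by apply/standardize_111; exists a.
    apply: (@subseq_trans _ (filter (pred1 a) w)); last exact: filter_subseq.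
    have /all_pred1P -> := filter_all (pred1 a) w.
    rewrite size_filter -(subnKC c3) nseqD; exact: prefix_subseq.
  apply/negP => sub; apply: av2; exists [:: a; b; a; b] => //.
  by apply/standardize_1212; exists a, b.
apply/andP; split; apply/containsP => -[t sub].
  case/standardize_111=> a et; rewrite et in sub.
  have := av1 a; rewrite leqNgt => /negP; apply.
  by have := leq_count_subseq (pred1 a) sub; rewrite count_nseq /= eqxx mul1n.
case/standardize_1212=> a [b [ltab et]].
by rewrite et in sub; have := av2 a b ltab; rewrite sub.
Qed.

Lemma subseq_cons_cat_notin (T : eqType) (x : T) t p r :
  x \notin p -> subseq (x :: t) (p ++ r) = subseq (x :: t) r.
Proof.
elim: p => //= y p IH; rewrite inE negb_or => /andP[/negPf -> xp].
exact: IH.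
Qed.

(** All copies of [a] are consecutive, so no other letter sits between two of them. *)
Lemma subseq_aba_block (T : eqType) (a y : T) k p r :
  a \notin p -> a \notin r -> y != a ->
  ~~ subseq [:: a; y; a] (p ++ nseq k a ++ r).
Proof.
move=> ap ar ya; rewrite subseq_cons_cat_notin //.
case: k => [|k] /=.
  by apply: contra ar => /mem_subseq; apply; rewrite inE eqxx.
rewrite eqxx subseq_cons_cat_notin; last first.
  by rewrite mem_nseq negb_and ya orbT.
by apply: contra ar => /mem_subseq; apply; rewrite !inE eqxx orbT.
Qed.

(** In a crossing each letter has the other one between its two occurrences, which a consecutive
    block does not allow. Used with [k = 1] to drop a singleton and with [k = 2] to drop a closed
    pair. *)
Lemma noncrossing_matching_block k (a : nat) p r :
  k <= 2 -> a \notin p -> a \notin r ->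
  noncrossing_matching (p ++ nseq k a ++ r) <-> noncrossing_matching (p ++ r).
Proof.
move=> k2 ap ar.
have sub : subseq (p ++ r) (p ++ nseq k a ++ r).
  by rewrite cat_subseq // suffix_subseq.
split=> [[cnt av]|[cnt av]]; split.
- by move=> x; apply: leq_trans (leq_count_subseq _ sub) (cnt x).
- move=> x y ltxy; apply: contra (av x y ltxy) => s.
  exact: subseq_trans s sub.
- move=> x; have := cnt x; rewrite !count_cat count_nseq /=.
  case: eqP => [<- _|]; last by rewrite mul0n.
  by rewrite (count_memPn ap) (count_memPn ar) mul1n addn0.
move=> x y ltxy; apply/negP => s.
have [xa|xa] := eqVneq x a.
  have nya : y != a by rewrite -xa gtn_eqF.
  move/negP: (subseq_aba_block k ap ar nya); apply; apply: subseq_trans s.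
  by rewrite -xa (prefix_subseq [:: x; y; x] [:: y]).
have [ya|ya] := eqVneq y a.
  move/negP: (subseq_aba_block k ap ar xa); apply.
  by apply: subseq_trans s; rewrite -ya (suffix_subseq [:: x]).
move/negP: (av x y ltxy); apply.
have e (q : seq nat) : a \notin q -> filter (predC1 a) q = q.
  by move=> aq; apply/all_filterP/allP => z zq; apply: contraNneq aq => <-.
(* As [x] and [y] both differ from [a], the pattern survives erasing every [a]. *)
suff <- : filter (predC1 a) (p ++ nseq k a ++ r) = p ++ r.
  by rewrite subseq_filter s /= xa ya.
by rewrite !filter_cat (e p) // (e r) // filter_nseq /= eqxx.
Qed.

(** * Recursive forms of RGFs, Motzkin paths and levels *)

(** [m] is the maximum of the letters already read; starting at 0 forces the first letter to be
    1. *)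
Fixpoint rgf_from (m : nat) (w : seq nat) : bool :=
  if w is a :: w' then (0 < a <= m.+1) && rgf_from (maxn m a) w' else true.

Lemma rgf_fromP m w :
  reflect (all (leq 1) w /\
           forall i, i < size w ->
             nth 0 w i <= (maxn m (\max_(j < i) nth 0 w j)).+1)
          (rgf_from m w).
Proof.
apply: (iffP idP); elim: w m => //= a w IH m.
  case/andP=> /andP[-> am] /IH[-> bnd]; split=> // -[|i] lti.
    by rewrite big_ord0 maxn0.
  by have := bnd i lti; rewrite big_ord_recl maxnA.
case=> /andP[-> al] bnd; rewrite /=; have := bnd 0 isT.
rewrite big_ord0 maxn0 => -> /=; apply: IH; split=> // i lti.
by have := bnd i.+1 lti; rewrite big_ord_recl maxnA.
Qed.

Lemma is_rgf_from w : is_rgf w = rgf_from 0 w.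
Proof.
apply/idP/rgf_fromP.
  case/and3P=> al hd /forallP bnd; split=> // -[|i] lti; rewrite max0n.
    by rewrite big_ord0 nth0; case: w hd {al bnd} lti => //= a w /eqP ->.
  by have := bnd (Ordinal lti); rewrite /= add1n.
case=> al bnd; apply/and3P; split=> //.
  case: w al bnd => //= a w /andP[a0 _] /(_ 0 isT); rewrite big_ord0 /=.
  by case: a a0 => [|[]].
by apply/forallP => i; apply/implyP => _; have := bnd i (ltn_ord i); rewrite max0n add1n.
Qed.

Fixpoint motzkin_from (h : nat) (P : seq step) : bool :=
  match P with
  | [::] => h == 0
  | Up :: P' => motzkin_from h.+1 P'
  | Horizontal :: P' => motzkin_from h P'
  | Down :: P' => (0 < h) && motzkin_from h.-1 P'
  end.

Fixpoint level_from (h : nat) (P : seq step) : nat :=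
  match P with
  | [::] => 0
  | Up :: P' => h + level_from h.+1 P'
  | Horizontal :: P' => h + level_from h P'
  | Down :: P' => h.-1 + level_from h.-1 P'
  end.

Lemma height0 P : height P 0 = 0%R.
Proof. by rewrite /height take0 big_nil. Qed.

Lemma height_cons s P i : height (s :: P) i.+1 = (rise s + height P i)%R.
Proof. by rewrite /height /= big_cons. Qed.

(** The Motzkin condition for a path starting at height [h], as induction on the path requires. *)
Definition nonneg_path (h : nat) (P : seq step) : Prop :=
  (h%:Z + height P (size P) = 0)%R /\
  forall i, i <= size P -> (0 <= h%:Z + height P i)%R.

Lemma nonneg_path_cons (h k : nat) s P :
  (h%:Z + rise s = k%:Z)%R -> nonneg_path k P <-> nonneg_path h (s :: P).
Proof.
move=> e; rewrite /nonneg_path /= height_cons addrA e; split=> -[z pos].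
  by split=> // -[_|i lei]; rewrite ?height0 ?addr0 // height_cons addrA e pos.
by split=> // i lei; rewrite -e -addrA -height_cons; apply: pos.
Qed.

Lemma motzkin_fromP (h : nat) P :
  reflect (nonneg_path h P) (motzkin_from h P).
Proof.
elim: P h => [|[] P IH] h /=.
- apply: (iffP eqP) => [->|[]]; rewrite ?height0 ?addr0; last by case.
  split=> [|i]; first by rewrite height0.
  by rewrite leqn0 => /eqP ->; rewrite height0.
- by apply: (equivP (IH h.+1)); apply: nonneg_path_cons; rewrite /rise; lia.
- by apply: (equivP (IH h)); apply: nonneg_path_cons; rewrite /rise; lia.
case: h => [|h] /=; last first.
  by apply: (equivP (IH h)); apply: nonneg_path_cons; rewrite /rise; lia.
by right=> -[_ /(_ 1 isT)]; rewrite height_cons height0.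
Qed.

Lemma is_motzkin_from P : is_motzkin P = motzkin_from 0 P.
Proof.
apply/andP/motzkin_fromP; rewrite /nonneg_path add0r.
  case=> /eqP -> /forallP pos; split=> // i lei.
  by rewrite add0r; apply: (pos (Ordinal (lei : i < (size P).+1))).
case=> -> pos; split=> //; apply/forallP => i.
by have := pos i (ltn_ord i); rewrite add0r.
Qed.

(** On a Motzkin path no down step starts at height 0, so the truncated [h.-1] agrees with the
    integer height. *)
Lemma level_fromE (h : nat) P :
  motzkin_from h P ->
  (\sum_(i < size P)
     Num.min (h%:Z + height P i) (h%:Z + height P i.+1) = (level_from h P)%:Z)%R.
Proof.
elim: P h => [|s P IH] h /=; first by rewrite big_ord0.
(* [k] is the height after the first step, whose level is therefore [minn h k]. *)
have step (k : nat) : (h%:Z + rise s = k%:Z)%R -> motzkin_from k P ->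
    (\sum_(i < (size P).+1)
       Num.min (h%:Z + height (s :: P) i) (h%:Z + height (s :: P) i.+1)
     = (minn h k + level_from k P)%:Z)%R.
  move=> e mot; rewrite big_ord_recl /= height_cons !height0 !addr0 e PoszD.
  congr (_ + _)%R; first lia.
  rewrite -(IH k mot); apply: eq_bigr => i _ /=.
  by rewrite /bump /= add1n !height_cons !addrA e.
case: s step => step /=.
- by move=> mot; rewrite (step h.+1) ?(minn_idPl _) // /rise; lia.
- by move=> mot; rewrite (step h) ?minnn // /rise; lia.
case: h step => [//|h] step /= mot.
by rewrite (step h) ?(minn_idPr _) // /rise; lia.
Qed.

Lemma level_from0 P : is_motzkin P -> `|level P|%N = level_from 0 P.
Proof.
rewrite is_motzkin_from => mot; rewrite -[RHS]absz_nat.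
rewrite -level_fromE // /level; congr `|_|%N; apply: eq_bigr => i _.
by rewrite /step_level !add0r.
Qed.

(** * Decoding paths, encoding words, and the statistic [rs] *)

(* [s] is the stack of open letters and [m] the maximum letter so far; a down
   step on the empty stack emits the junk letter 0. *)
Fixpoint decode (s : seq nat) (m : nat) (P : seq step) : seq nat :=
  match P with
  | [::] => [::]
  | Up :: P' => m.+1 :: decode (m.+1 :: s) m.+1 P'
  | Horizontal :: P' => m.+1 :: decode s m.+1 P'
  | Down :: P' => head 0 s :: decode (behead s) m P'
  end.

(** In an RGF every positive letter up to the running maximum [m] has already occurred, so comparing
    with [m] detects a second occurrence. *)
Fixpoint encode (m : nat) (w : seq nat) : seq step :=
  if w is a :: w' then
    if a <= m then Down :: encode m w'
    else (if a \in w' then Up else Horizontal) :: encode a w'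
  else [::].

Lemma size_decode s m P : size (decode s m P) = size P.
Proof. by elim: P s m => //= -[] P IH s m /=; rewrite IH. Qed.

Lemma size_encode m w : size (encode m w) = size w.
Proof. by elim: w m => //= a w IH m; case: ifP => /=; rewrite IH. Qed.

Lemma path_gtn_leq m n s : m <= n -> path gtn m s -> path gtn n s.
Proof.
by case: s => //= a s lemn /andP[lta ->]; rewrite (leq_trans lta lemn).
Qed.

Lemma path_gtn_mem m s x : path gtn m s -> x \in s -> x < m.
Proof.
have tr : transitive gtn by move=> y z t /= h1 h2; apply: ltn_trans h2 h1.
by move=> /(order_path_min tr) /allP; apply.
Qed.

(** The first hypothesis says that the stack, read from its top, strictly decreases and has letters
    at most [m]. New letters exceed [m], and the path descends to height 0, so every stack letter
    gets emitted. *)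
Lemma mem_decode s m P x :
  path gtn m.+1 s -> motzkin_from (size s) P -> x <= m ->
  (x \in decode s m P) = (x \in s).
Proof.
elim: P s m => [|[] P IH] s m /=; first by case: s.
- move=> sm mot lex; rewrite inE ltn_eqF //=.
  by rewrite IH ?inE ?ltn_eqF //= ?leqnn // leqW.
- by move=> sm mot lex; rewrite inE ltn_eqF //= IH ?leqW // (path_gtn_leq _ sm).
case: s => [//|a s] /= /andP[lta sm] mot lex.
by rewrite !inE IH // (path_gtn_leq _ sm) // ltnW.
Qed.

(** Popped letters are at most [m], and a new letter [m.+1] recurs exactly when it was pushed, so
    each step can be recognized. *)
Lemma decodeK s m P :
  path gtn m.+1 s -> motzkin_from (size s) P -> encode m (decode s m P) = P.
Proof.
elim: P s m => [//|[] P IH] s m /=.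
- move=> sm mot; rewrite ltnn mem_decode /= ?ltnSn // inE eqxx /=.
  by rewrite IH //= ltnSn.
- move=> sm mot; have sm1 := path_gtn_leq (leqnSn _) sm.
  rewrite ltnn mem_decode // IH //.
  by case: ifP => // /(path_gtn_mem sm); rewrite ltnn.
case: s => [//|a s] /= /andP[lta sm] mot; rewrite -ltnS lta IH //.
exact: path_gtn_leq (ltnW lta) sm.
Qed.

Lemma rs_cons a w : rs (a :: w) = size (undup [seq b <- w | b < a]) + rs w.
Proof. by rewrite /rs /= big_ord_recl /rs_letter /= drop0. Qed.

Lemma rs_decode s m P :
  path gtn m.+1 s -> motzkin_from (size s) P ->
  rs (decode s m P) = level_from (size s) P.
Proof.
(* A strictly decreasing stack has no repetitions, so its size counts the distinct smaller letters
   still to come. *)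
have size_below a t w : path gtn a t ->
    (forall x, x < a -> (x \in w) = (x \in t)) ->
    size (undup [seq b <- w | b < a]) = size t.
  move=> sm memw; apply/perm_size/uniq_perm; first exact: undup_uniq.
    apply: (@sorted_uniq _ gtn); last exact: path_sorted sm.
      by move=> y z u /= h1 h2; apply: ltn_trans h2 h1.
    exact: ltnn.
  move=> x; rewrite mem_undup mem_filter; apply/andP/idP => [[xa]|xt].
    by rewrite memw.
  by have xa := path_gtn_mem sm xt; rewrite memw.
elim: P s m => [|[] P IH] s m /=; first by rewrite /rs big_ord0.
- move=> sm mot; rewrite rs_cons IH //= ?ltnSn //; congr (_ + _).
  apply: size_below => // x ltx.
  by rewrite mem_decode //= ?ltnSn ?inE ?ltn_eqF // ltnW.
- move=> sm mot; have sm1 := path_gtn_leq (leqnSn _) sm.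
  rewrite rs_cons IH //=; congr (_ + _); apply: size_below => // x ltx.
  by rewrite mem_decode // ltnW.
case: s => [//|a s] /= /andP[lta sm] mot.
have sm1 := path_gtn_leq (ltnW lta) sm.
rewrite rs_cons IH //=; congr (_ + _); apply: size_below => // x ltx.
by rewrite mem_decode // -ltnS (ltn_trans ltx).
Qed.

(** * Words compatible with a stack, and decoding as the inverse of encoding *)

(* [w] may follow a prefix with maximum [m] and stack [s] of open letters; the
   closed letters and singletons of the prefix can be dropped, so that only
   [rev s ++ w] has to be noncrossing. *)
Definition valid (s : seq nat) (m : nat) (w : seq nat) : Prop :=
  [/\ rgf_from m w, noncrossing_matching (rev s ++ w), {subset s <= w} &
      forall a, a \in w -> a <= m -> a \in s].

(** Pushing [m.+1] only moves the boundary between stack and word; the concatenation tested for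
    crossings is unchanged. *)
Lemma valid_open s m w :
  path gtn m.+1 s -> m.+1 \in w ->
  valid s m (m.+1 :: w) <-> valid (m.+1 :: s) m.+1 w.
Proof.
move=> sm mw; rewrite /valid rev_cons cat_rcons /= ltnSn.
rewrite (maxn_idPr (leqnSn m)) /=.
have ltm x : x \in s -> (x == m.+1) = false.
  by move=> /(path_gtn_mem sm) ltx; rewrite ltn_eqF.
split=> -[rw nc sub mem]; split=> //.
- move=> x; rewrite inE => /predU1P[->//|xs].
  by have := sub x xs; rewrite inE ltm.
- move=> x xw; rewrite inE leq_eqVlt ltnS => /predU1P[->|lex].
    by rewrite eqxx.
  by rewrite (mem x) ?orbT // inE xw orbT.
- by move=> x xs; rewrite inE sub ?orbT // inE xs orbT.
move=> x; rewrite inE => /predU1P[->|xw lex]; first by rewrite ltnn.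
by have := mem x xw (leqW lex); rewrite inE ltn_eqF.
Qed.

Lemma valid_singleton s m w :
  path gtn m.+1 s -> m.+1 \notin w ->
  valid s m (m.+1 :: w) <-> valid s m.+1 w.
Proof.
move=> sm mw; rewrite /valid /= ltnSn (maxn_idPr (leqnSn m)) /=.
have ms : m.+1 \notin s.
  by apply/negP => /(path_gtn_mem sm); rewrite ltnn.
have nce : noncrossing_matching (rev s ++ m.+1 :: w) <->
           noncrossing_matching (rev s ++ w).
  by apply: (@noncrossing_matching_block 1); rewrite ?mem_rev.
split=> -[rw nc sub mem]; split=> //; try exact/nce.
- move=> x xs; have := sub x xs; rewrite inE => /predU1P[xm|//].
  by rewrite xm (negPf ms) in xs.
- move=> x xw; rewrite leq_eqVlt ltnS => /predU1P[xm|lex].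
    by rewrite xm (negPf mw) in xw.
  by rewrite mem // inE xw orbT.
- by move=> x xs; rewrite inE sub ?orbT.
move=> x; rewrite inE => /predU1P[->|xw lex]; first by rewrite ltnn.
by rewrite mem // leqW.
Qed.

Lemma valid_close a s m w :
  path gtn m.+1 (a :: s) -> a \notin w ->
  valid (a :: s) m (a :: w) <-> 0 < a /\ valid s m w.
Proof.
move=> /= /andP[lta sa] aw; rewrite /valid rev_cons cat_rcons /=.
have as_ : a \notin s by apply/negP => /(path_gtn_mem sa); rewrite ltnn.
have nce : noncrossing_matching (rev s ++ a :: a :: w) <->
           noncrossing_matching (rev s ++ w).
  by apply: (@noncrossing_matching_block 2); rewrite ?mem_rev.
rewrite (ltnW lta) (maxn_idPl (lta : a <= m)) andbT.
split=> [[/andP[a0 rw] nc sub mem]|[a0 [rw nc sub mem]]]; split=> //.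
- split=> //; first exact/nce.
    move=> x xs; have := sub x; rewrite !inE xs orbT => /(_ isT) /predU1P[xa|//].
    by rewrite xa (negPf as_) in xs.
  move=> x xw lex; have := mem x; rewrite !inE xw orbT => /(_ isT lex).
  by case/predU1P=> // xa; rewrite xa (negPf aw) in xw.
- by rewrite a0.
- exact/nce.
- by move=> x; rewrite !inE => /predU1P[->|/sub ->]; rewrite ?eqxx ?orbT.
by move=> x; rewrite !inE => /predU1P[->|xw lex]; rewrite ?eqxx // (mem x) ?orbT.
Qed.

(* A letter on the stack above [a] would cross [a]. *)
Lemma valid_top s m a w :
  path gtn m.+1 s -> a <= m -> valid s m (a :: w) ->
  a \notin w /\ exists s', s = a :: s'.
Proof.
move=> sm lea [_ [cnt av] sub mem].
have as_ : a \in s by rewrite mem // inE eqxx.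
split.
  (* One [a] on the stack, the one being read and another in [w] would make three. *)
  apply/negP => aw; have := cnt a; rewrite count_cat /= eqxx.
  have c1 : 0 < count_mem a (rev s) by rewrite -has_count has_pred1 mem_rev.
  have c2 : 0 < count_mem a w by rewrite -has_count has_pred1.
  by apply/negP; rewrite -ltnNge (leq_add c1) // ltnS.
case: s sm as_ sub cnt av {mem} => [//|b s] /= /andP[_ sb] as_ sub _ av.
move: as_; rewrite inE => /predU1P[->|as_]; first by exists s.
have ltab := path_gtn_mem sb as_.
have bw : b \in w.
  by have := sub b; rewrite !inE eqxx gtn_eqF //= => /(_ isT).
case/negP: (av a b ltab); rewrite rev_cons cat_rcons.
rewrite -[[:: a; b; a; b]]/([:: a] ++ [:: b; a; b]).
by rewrite cat_subseq ?sub1seq ?mem_rev //= !eqxx sub1seq.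
Qed.

(** Positivity of the stack makes popped letters legal in an RGF. *)
Lemma valid_decode s m P :
  path gtn m.+1 s -> all (leq 1) s -> motzkin_from (size s) P ->
  valid s m (decode s m P).
Proof.
elim: P s m => [|[] P IH] s m /=.
- by case: s.
- move=> sm s0 mot; apply/valid_open => //.
    by rewrite mem_decode //= ?ltnSn // inE eqxx.
  by apply: IH; rewrite //= ltnSn.
- move=> sm s0 mot; have sm1 := path_gtn_leq (leqnSn _) sm.
  apply/valid_singleton => //; last exact: IH.
  by rewrite mem_decode //; apply/negP => /(path_gtn_mem sm); rewrite ltnn.
case: s => [//|a s] /= /andP[lta sm] /andP[a0 s0] mot.
have sm1 := path_gtn_leq (ltnW lta) sm.
apply/valid_close; rewrite /= ?lta //; last by split=> //; apply: IH.
by rewrite mem_decode //; apply/negP => /(path_gtn_mem sm); rewrite ltnn.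
Qed.

(** By restricted growth the first letter is either [m.+1], or at most [m] and then the top of the
    stack by [valid_top]; each case passes to a shorter word. *)
Lemma encodeK s m w :
  path gtn m.+1 s -> valid s m w ->
  motzkin_from (size s) (encode m w) /\ decode s m (encode m w) = w.
Proof.
elim: w s m => [|a w IH] s m sm val.
  (* Every stack letter must still occur, so at the empty word the stack is empty and the path ends
     at height 0. *)
  by case: s val {sm} => // b s [_ _ /(_ b)]; rewrite inE eqxx => /(_ isT).
rewrite /=; have [lea|lta] := leqP a m.
  have [aw [s' es]] := valid_top sm lea val; subst s.
  have [_ val'] := (valid_close sm aw).1 val; case/andP: sm => lta sm.
  by have /= [-> ->] := IH s' m (path_gtn_leq (ltnW lta) sm) val'.
have ea : a = m.+1.
  by case: val => /= /andP[/andP[_ lea] _] _ _ _; apply/eqP; rewrite eqn_leq lea.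
rewrite ea in val *; case: ifP => [aw|/negbT aw] /=.
  have [] := IH (m.+1 :: s) m.+1 _ ((valid_open sm aw).1 val).
    by rewrite /= ltnSn.
  by move=> -> ->.
have sm1 := path_gtn_leq (leqnSn _) sm.
by have [-> ->] := IH s m.+1 sm1 ((valid_singleton sm aw).1 val).
Qed.

(** With empty stack and maximum 0, the last clause of [valid] says that 0 is not a letter, which
    holds in an RGF. *)
Lemma validP w :
  reflect (valid [::] 0 w)
    [&& is_rgf w, avoids w [:: 1; 1; 1] & avoids w [:: 1; 2; 1; 2]].
Proof.
rewrite is_rgf_from; apply: (iffP andP) => [[rw /avoidsP nc]|[rw nc _ _]].
  split=> // a aw; rewrite leqn0 => /eqP a0; rewrite a0 in aw.
  by have [/allP /(_ 0 aw)] := rgf_fromP _ _ rw.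
by split=> //; apply/avoidsP.
Qed.

(** * Transfer to tuples and comparison of the two sums *)

(** The maximum grows by at most one per step. This keeps decoded letters in the range of
    ['I_n.+1]. *)
Lemma decode_bound s m P :
  all (geq m) s -> motzkin_from (size s) P ->
  all (geq (m + size P)) (decode s m P).
Proof.
elim: P s m => [//|[] P IH] s m /= sm mot; rewrite addnS -addSn.
- rewrite leq_addr /=; apply: IH => //=; rewrite leqnn /=.
  by apply: sub_all sm => x /leqW.
- by rewrite leq_addr /=; apply: IH => //; apply: sub_all sm => x /leqW.
case: s sm mot => [//|a s] /= /andP[lea sm] mot.
rewrite (leq_trans lea) ?addSn ?leqW ?leq_addr //=.
by apply: sub_all (IH s m sm mot) => x /leqW.
Qed.

Lemma decode_tuple_subproof n (P : n.-tuple step) :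
  size [seq inord a : 'I_n.+1 | a <- decode [::] 0 P] == n.
Proof. by rewrite size_map size_decode size_tuple. Qed.

(** [inord] would send an out-of-range letter to 0; by [decode_bound] this does not happen on
    Motzkin paths. *)
Definition decode_tuple n (P : n.-tuple step) : n.-tuple 'I_n.+1 :=
  Tuple (decode_tuple_subproof P).

Lemma encode_tuple_subproof n (t : n.-tuple 'I_n.+1) :
  size (encode 0 (word t)) == n.
Proof. by rewrite size_encode size_map size_tuple. Qed.

Definition encode_tuple n (t : n.-tuple 'I_n.+1) : n.-tuple step :=
  Tuple (encode_tuple_subproof t).

Lemma encode_tupleK n (t : n.-tuple 'I_n.+1) :
  valid [::] 0 (word t) -> decode_tuple (encode_tuple t) = t.
Proof.
move=> val; apply: val_inj => /=; have [_ ->] := encodeK (isT : path gtn 1 [::]) val.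
rewrite /word -map_comp -[RHS]map_id; apply: eq_map => a /=; exact: inord_val.
Qed.

Lemma word_decode_tuple n (P : n.-tuple step) :
  motzkin_from 0 P -> word (decode_tuple P) = decode [::] 0 P.
Proof.
move=> mot; rewrite /word /= -map_comp -[RHS]map_id; apply/eq_in_map => a aP /=.
rewrite inordK // ltnS; have /allP /(_ a aP) := @decode_bound [::] 0 P isT mot.
by rewrite /= add0n size_tuple.
Qed.

Theorem theorem5p10 (n : nat) :
  RS n [:: 1; 1; 1] [:: 1; 2; 1; 2] = motzkin_level_poly n.
Proof.
rewrite /RS /motzkin_level_poly.
rewrite (reindex_onto (@decode_tuple n) (@encode_tuple n)); last first.
  by move=> t /validP; apply: encode_tupleK.
apply: eq_big => [P|P].
  (* Reindexing also demands that encoding the decoded path returns [P]; then [P] encodes a valid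
     word and is a Motzkin path by [encodeK]. *)
  rewrite is_motzkin_from; apply/andP/idP => [[/validP val /eqP <-]|mot].
    by have [] := encodeK (isT : path gtn 1 [::]) val.
  have wP := word_decode_tuple mot; split.
    by apply/validP; rewrite wP; apply: valid_decode.
  by apply/eqP/val_inj => /=; rewrite wP decodeK.
case/andP=> /validP val /eqP eP.
have mot : motzkin_from 0 P by rewrite -eP; have [] := encodeK (isT : path gtn 1 [::]) val.
by rewrite word_decode_tuple // rs_decode // level_from0 // is_motzkin_from.
Qed.
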